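(* Let $k \geq 2$ and $n \geq 2$ be integers such that either $n = 2^k+4$ or $2^k-4 \leq n \leq 2^k+2$, and suppose that $n$ is not of the form $2^a-2$ for any integer $a \geq 2$. Then $\mathrm{sa}(Q_n) = \lfloor n/2 \rfloor + 2$.
   Context: $Q_n$ denotes the $n$-dimensional hypercube: the graph whose vertices are all binary vectors of length $n$, two vertices being adjacent if and only if they differ in exactly one coordinate. A star is a complete bipartite graph $K_{1,m}$ with $m\ge 1$. A galaxy (star forest) is a union of vertex-disjoint stars. The star arboricity $\mathrm{sa}(G)$ of a finite simple graph $G$ is the minimum number of galaxies (subgraphs of $G$) whose edge sets partition the edge set of $G$. *)

(* Defs.v *)
From mathcomp Require Import all_boot.

Set Implicit Arguments.
Unset Strict Implicit.
Unset Printing Implicit Defensive.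

Record sgraph := SGraph {
  vertex :> finType;
  adj : rel vertex;
  adj_sym : symmetric adj;
  adj_irr : irreflexive adj }.

(* An edge is the unordered pair of its two endpoints. *)
Definition edges (G : sgraph) : {set {set G}} :=
  [set e : {set G} | [exists x, exists y, adj x y && (e == [set x; y])]].

(* Stars and galaxies have no isolated vertex, so they are represented by      *)
(* their edge sets; [cover S] is then the vertex set of the graph with edge    *)
(* set [S].                                                                    *)

(* [S] is the edge set of a K_{1,m} with m >= 1, centre [c] and leaves [L].    *)
Definition is_star (T : finType) (S : {set {set T}}) : bool :=
  [exists c : T, exists L : {set T},
    [&& L != set0, c \notin L & S == [set [set c; v] | v in L]]].

Definition is_galaxy (T : finType) (F : {set {set T}}) : bool :=
  [exists P : {set {set {set T}}},
    [&& [forall S in P, is_star S],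
        [forall S in P, forall S' in P,
           (S != S') ==> [disjoint cover S & cover S']]
      & F == cover P]].

(* [partition] requires nonempty blocks; this does not change the minimum      *)
(* number of blocks.                                                           *)
Definition galaxy_partition (G : sgraph) (D : {set {set {set G}}}) : bool :=
  partition D (edges G) && [forall F in D, is_galaxy F].

Lemma galaxy_partition_exists (G : sgraph) :
  exists m, [exists D : {set {set {set G}}},
               galaxy_partition D && (#|D| == m)].
Proof.
pose D : {set {set {set G}}} := [set [set e] | e in edges G].
exists #|D|; apply/existsP; exists D; rewrite eqxx andbT.
apply/andP; split.
  apply/and3P; split.
  - rewrite /cover big_imset /=; last by move=> x y _ _; apply: set1_inj.
    apply/eqP/setP=> e; apply/bigcupP/idP => [[f fE]|eE].
      by move=> /set1P->.
    by exists e; rewrite ?set11.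
  - apply/trivIsetP=> _ _ /imsetP[e _ ->] /imsetP[f _ ->] nef.
    by rewrite disjoints1 inE; apply: contraNN nef => /eqP->.
  - apply/negP=> /imsetP[e _ /setP/(_ e)]; by rewrite !inE eqxx.
apply/forall_inP=> _ /imsetP[e eE ->].
move: eE; rewrite inE => /existsP[x /existsP[y /andP[xy /eqP->]]].
apply/existsP; exists [set [set [set x; y]]]; apply/and3P; split.
- apply/forall_inP=> S /set1P->.
  apply/existsP; exists x; apply/existsP; exists [set y]; apply/and3P; split.
  + by apply/set0Pn; exists y; rewrite inE.
  + by rewrite inE; apply: contraTneq xy => ->; rewrite adj_irr.
  + by rewrite imset_set1.
- apply/forall_inP=> S /set1P->; apply/forall_inP=> S' /set1P->.
  by rewrite eqxx.
- by rewrite /cover big_set1.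
Qed.

Definition sa (G : sgraph) : nat := ex_minn (galaxy_partition_exists G).

Definition cube_adj (n : nat) (x y : {ffun 'I_n -> bool}) : bool :=
  #|[set i | x i != y i]| == 1.

Lemma cube_adj_sym (n : nat) : symmetric (@cube_adj n).
Proof.
move=> x y; rewrite /cube_adj; congr (_ == _); apply: eq_card => i.
by rewrite !inE eq_sym.
Qed.

Lemma cube_adj_irr (n : nat) : irreflexive (@cube_adj n).
Proof.
move=> x; rewrite /cube_adj (_ : [set i | _] = set0) ?cards0 //.
by apply/setP=> i; rewrite !inE eqxx.
Qed.

Definition hypercube (n : nat) : sgraph :=
  SGraph (@cube_adj_sym n) (@cube_adj_irr n).

(* Main.v *)
Require Import Defs.
From mathcomp Require Import all_boot.
From mathcomp Require Import all_algebra zify.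
Import GRing.Theory.

(** Orient every edge of a galaxy from a leaf of its star to the centre. A
partition of the edges into galaxies then becomes an edge colouring together
with an orientation in which an outgoing edge of a vertex is the only edge of
its colour at that vertex; conversely every such pair comes from galaxies
([star_colouring_of_partition], [sa_le_colours]). On a cube, edges are
addressed as a vertex [x] together with a direction [i], which gives
[cube_colouring].

Lower bound. The outgoing edges at a vertex have distinct colours, and if they
used all the colours they would be all the edges at the vertex. Hence with at
most n/2 + 1 colours and n > 2 every out-degree is at most n/2; since the
average out-degree is exactly n/2, each out-degree equals n/2, there are
exactly n/2 + 1 colours, and the n/2 incoming edges of a vertex all have the
one colour that its outgoing edges miss. So each colour class splits the
vertices into stars with n/2 leaves, n/2 + 1 divides 2^n, and n is of the form
2^a - 2 ([few_colours_power2]).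

Upper bound. Label the directions by nonzero vectors of V = F_2^r and give each
vertex its syndrome, the sum of the labels of its nonzero coordinates. Colour
an edge by the syndrome of its head: this is valid as soon as the outgoing
edges of a vertex have distinct labels, because heads reached along distinct
labels have distinct syndromes, none of them the syndrome of the tail. If each
nonzero vector labels two directions, the edges in these two directions form
4-cycles, which are oriented cyclically; this gives 2^r galaxies for
n = 2^(r+1) - 2. If instead one vector labels five directions, and the copies
of Q_5 that they span may use two further colours, a fixed pattern on Q_5 gives
2^r + 2 galaxies for n = 2^(r+1) + 1 ([head_colouring_five]). The remaining
dimensions follow by passing to subcubes, and by adding a matching or a copy of
the colouring of Q_6 to increase the dimension. *)

Set Implicit Arguments.
Unset Strict Implicit.
Unset Printing Implicit Defensive.

(** * Galaxies as oriented edge colourings *)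

(** [leaf x y] says that the edge from [x] to [y] is directed to [y], the centre
of its star. The colours in use are confined to [A], so that the galaxies of a
partition can serve as their own colours. *)
Definition star_colouring (G : sgraph) (C : finType) (A : {set C})
    (leaf : rel G) (col : G -> G -> C) : Prop :=
  [/\ forall x y, adj x y -> leaf y x = ~~ leaf x y,
      forall x y, adj x y -> col x y \in A /\ col y x = col x y
    & forall x y z, adj x y -> adj x z -> leaf x y -> col x y = col x z ->
        y = z].

(** A leaf of a star of [F] meets no second edge of that star, and none of
another star because stars of [F] are disjoint. *)
Lemma galaxy_end (T : finType) (F : {set {set T}}) (x y : T) :
  is_galaxy F -> x != y -> [set x; y] \in F ->
  [forall z, ([set x; z] \in F) ==> (z == y)]
  || [forall z, ([set y; z] \in F) ==> (z == x)].
Proof.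
case/existsP=> P /and3P[/forall_inP starP /forall_inP disjP /eqP->] xy.
suff leafP c v (L : {set T}) S : S \in P -> c \notin L -> v \in L ->
    S = [set [set c; w] | w in L] ->
    [forall z, ([set v; z] \in cover P) ==> (z == c)].
  case/bigcupP=> S SP.
  have /existsP[c /existsP[L /and3P[_ cL /eqP defS]]] := starP S SP.
  rewrite {1}defS => /imsetP[v vL exy].
  have cv : c != v by apply: contraNneq cL => ->.
  have vS := leafP c v L S SP cL vL defS.
  have: x \in [set c; v] by rewrite -exy set21.
  have: y \in [set c; v] by rewrite -exy set22.
  rewrite !inE => /orP[]/eqP ey /orP[]/eqP ex; subst; rewrite ?eqxx // in xy *.
    by rewrite vS.
  by rewrite vS orbT.
move=> SP cL vL defS; apply/forallP=> z; apply/implyP=> /bigcupP[S' S'P vzS'].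
have eSS' : S = S'.
  apply: contraTeq (forall_inP (disjP S SP) S' S'P) => nSS'.
  rewrite nSS' /=; apply/pred0Pn; exists v => /=; apply/andP; split.
    apply/bigcupP; exists [set c; v]; rewrite ?set22 // defS.
    exact: imset_f.
  by apply/bigcupP; exists [set v; z]; rewrite ?set21.
move: vzS'; rewrite -eSS' defS => /imsetP[w wL evz].
have vc : v != c by apply: contraNneq cL => <-.
have: c \in [set v; z] by rewrite evz set21.
by rewrite !inE eq_sym (negPf vc) eq_sym.
Qed.

Lemma adj_edges (G : sgraph) (x y : G) : adj x y -> [set x; y] \in edges G.
Proof.
by move=> xy; rewrite inE; apply/existsP; exists x; apply/existsP; exists y;
  rewrite xy eqxx.
Qed.

Lemma adj_neq (G : sgraph) (x y : G) : adj x y -> x != y.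
Proof. by apply: contraTneq => ->; rewrite adj_irr. Qed.

Lemma set2_inj (T : finType) (x y z : T) : [set x; y] = [set x; z] -> y = z.
Proof.
move=> e; have: y \in [set x; z] by rewrite -e set22.
have: z \in [set x; y] by rewrite e set22.
by rewrite !inE => /orP[]/eqP-> // /orP[]/eqP->.
Qed.

(** When both ends of an edge are leaves (a star K_{1,1}), the enumeration order
of the vertices decides which end counts as the centre. *)
Lemma star_colouring_of_partition (G : sgraph) (D : {set {set {set G}}}) :
  galaxy_partition D ->
  exists leaf col, @star_colouring G _ D leaf col.
Proof.
case/andP=> partD /forall_inP galD.
have [/eqP covD trivD _] := and3P partD.
pose col (x y : G) := pblock D [set x; y].
pose only (x y : G) := [forall z, ([set x; z] \in col x y) ==> (z == y)].
pose leaf x y :=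
  only x y && (only y x ==> (enum_rank x < enum_rank y)).
have colC x y : col y x = col x y by rewrite /col setUC.
have colD x y : adj x y -> col x y \in D.
  by move=> xy; rewrite pblock_mem // covD adj_edges.
have colE x y : adj x y -> [set x; y] \in col x y.
  by move=> xy; rewrite mem_pblock covD adj_edges.
exists leaf, col; split=> [x y xy|x y xy|x y z xy xz].
- have := galaxy_end (galD _ (colD _ _ xy)) (adj_neq xy) (colE _ _ xy).
  rewrite -/(only x y) -(colC x y) -/(only y x) /leaf.
  have := adj_neq xy; rewrite -(inj_eq enum_rank_inj) -(inj_eq val_inj) /=.
  by case: (only x y); case: (only y x) => //=; case: ltngtP.
- by split; [apply: colD | apply: colC].
- by case/andP=> /forallP/(_ z) + _ eyz; rewrite {1}eyz colE // => /eqP.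
Qed.

(** In a colour class, a vertex with an incoming edge has no outgoing edge and
every vertex has at most one outgoing edge; so the edges coming into the various
vertices form disjoint stars. *)
Lemma sa_le_colours (G : sgraph) (C : finType) (A : {set C}) leaf col :
  @star_colouring G C A leaf col -> sa G <= #|A|.
Proof.
case=> leafC colC leafP.
pose colour_class c :=
  [set e in edges G | [forall x, forall y,
     (adj x y && (e == [set x; y])) ==> (col x y == c)]].
have classE c x y : adj x y -> ([set x; y] \in colour_class c) = (col x y == c).
  move=> xy; rewrite inE adj_edges //=; apply/forallP/idP => [/(_ x)/forallP/(_ y)|].
    by rewrite xy eqxx.
  move=> /eqP colxy x'; apply/forallP=> y'; apply/implyP=> /andP[xy' /eqP e].
  have: x' \in [set x; y] by rewrite e set21.
  rewrite !inE => /orP[]/eqP ex; subst x'.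
    by rewrite -(set2_inj e) colxy.
  by rewrite -(@set2_inj _ y x y') ?(proj2 (colC _ _ xy)) ?colxy // setUC.
have classP c e :
  reflect (exists x y, [/\ adj x y, leaf x y, col x y = c & e = [set x; y]])
    (e \in colour_class c).
  apply: (iffP idP) => [ec|[x [y [xy _ colxy ->]]]]; last by rewrite classE ?colxy.
  have: e \in edges G by move: ec; rewrite inE => /andP[].
  rewrite inE => /existsP[x /existsP[y /andP[xy /eqP ee]]].
  have colxy : col x y = c by apply/eqP; rewrite -classE // -ee.
  have [lxy|lyx] := boolP (leaf x y); first by exists x, y.
  exists y, x; rewrite adj_sym leafC // lyx (proj2 (colC _ _ xy)).
  by rewrite setUC.
(* Unused colours give empty classes, which a partition excludes. *)
pose D := [set colour_class c | c in A] :\ set0.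
have cardD : #|D| <= #|A|.
  exact: leq_trans (subset_leq_card (subD1set _ _)) (leq_imset_card _ _).
apply: leq_trans cardD; rewrite /sa; case: ex_minnP => m _; apply.
apply/existsP; exists D; rewrite eqxx andbT; apply/andP; split.
  apply/and3P; split; last by rewrite !inE eqxx.
    apply/eqP/setP=> e; apply/bigcupP/idP => [[F]|eE].
      by case/setD1P=> _ /imsetP[c _ ->]; rewrite inE => /andP[].
    move: (eE); rewrite inE => /existsP[x /existsP[y /andP[xy /eqP ee]]].
    have ec : e \in colour_class (col x y) by rewrite ee classE.
    exists (colour_class (col x y)) => //; apply/setD1P; split.
      by apply/set0Pn; exists e.
    by apply: imset_f; have [] := colC _ _ xy.
  apply/trivIsetP=> _ _ /setD1P[_ /imsetP[c _ ->]] /setD1P[_ /imsetP[c' _ ->]] ncc'.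
  apply/pred0Pn => -[e /= /andP[/classP[x [y [xy _ colxy ->]]]]].
  by rewrite classE // colxy => /eqP ecc'; rewrite ecc' eqxx in ncc'.
apply/forall_inP=> _ /setD1P[_ /imsetP[c _ ->]].
pose leaves y := [set x | [&& adj x y, leaf x y & col x y == c]].
pose star y := [set [set y; x] | x in leaves y].
apply/existsP; exists [set star y | y in [set y | leaves y != set0]].
have starP v y : v \in cover (star y) ->
    (v = y /\ leaves y != set0) \/ v \in leaves y.
  case/bigcupP=> _ /imsetP[x xy ->]; rewrite !inE => /orP[]/eqP->.
    by left; split=> //; apply/set0Pn; exists x.
  by right; move: xy; rewrite inE.
have centre_not_leaf y y' : leaves y != set0 -> y \notin leaves y'.
  case/set0Pn=> x; rewrite !inE => /and3P[xy lxy /eqP colxy].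
  apply/negP => /and3P[yy' lyy' /eqP colyy'].
  have yx : adj y x by rewrite adj_sym.
  have exy' : y' = x.
    by apply: (leafP y) => //; rewrite colyy' (proj2 (colC _ _ xy)).
  by move: lyy'; rewrite exy' leafC // lxy.
apply/and3P; split.
- apply/forall_inP=> _ /imsetP[y + ->]; rewrite inE => y0.
  apply/existsP; exists y; apply/existsP; exists (leaves y).
  by rewrite y0 eqxx andbT inE adj_irr.
- apply/forall_inP=> _ /imsetP[y + ->]; rewrite inE => y0.
  apply/forall_inP=> _ /imsetP[y' + ->]; rewrite inE => y'0.
  apply/implyP; apply: contraNT => /pred0Pn[v /= /andP[/starP vy /starP vy']].
  apply/eqP; congr star.
  case: vy vy' => [[-> _]|vy] [[e _]|vy'] //.
  + by move: (centre_not_leaf y y' y0); rewrite vy'.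
  + by move: (centre_not_leaf y' y y'0); rewrite -e vy.
  + move: vy vy'; rewrite !inE => /and3P[vy lvy /eqP cvy] /and3P[vy' lvy' /eqP cvy'].
    by apply: (leafP v) => //; rewrite cvy.
- apply/eqP/setP=> e; apply/classP/bigcupP => [[x [y [xy lxy colxy ->]]]|].
    have xL : x \in leaves y by rewrite inE xy lxy colxy eqxx.
    exists (star y); last by rewrite setUC; apply: imset_f.
    by apply: imset_f; rewrite inE; apply/set0Pn; exists x.
  case=> _ /imsetP[y _ ->] /imsetP[x + ->]; rewrite inE => /and3P[xy lxy /eqP cxy].
  by exists x, y; rewrite setUC.
Qed.

(** * Colourings of cubes *)

Definition flip (I : finType) (x : {ffun I -> bool}) (i : I) : {ffun I -> bool} :=
  [ffun j => x j (+) (j == i)].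

Lemma flipK (I : finType) (i : I) : involutive (fun x => flip x i).
Proof. by move=> x; apply/ffunP=> j; rewrite !ffunE addbK. Qed.

Lemma flip_inj (I : finType) (x : {ffun I -> bool}) : injective (flip x).
Proof.
move=> i j /ffunP/(_ i); rewrite !ffunE eqxx => /addbI/esym/eqP//.
Qed.

Lemma cube_adjP (n : nat) (x y : {ffun 'I_n -> bool}) :
  reflect (exists i, y = flip x i) (cube_adj x y).
Proof.
apply: (iffP cards1P) => [[i xyi]|[i ->]]; exists i.
  apply/ffunP=> j; rewrite ffunE.
  have := in_set1 j i; rewrite -xyi inE => <-.
  by case: (x j); case: (y j).
by apply/setP=> j; rewrite !inE ffunE; case: (x j); case: (j == i).
Qed.

(** [o x i] says that the edge from [x] in direction [i] is directed away from
[x], and [g x i] is its colour. Directions form an arbitrary finite type, so that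
products of cubes are disjoint sums of direction types. *)
Definition cube_colouring (I : finType) (C : Type)
    (o : {ffun I -> bool} -> I -> bool) (g : {ffun I -> bool} -> I -> C) :=
  [/\ forall x i, o (flip x i) i = ~~ o x i,
      forall x i, g (flip x i) i = g x i
    & forall x i j, o x i -> g x i = g x j -> i = j].

Definition cube_colourable (I : finType) (C : Type) :=
  exists o g, @cube_colouring I C o g.

Lemma cube_colouring_of_sa (n : nat) :
  exists (C : finType) (A : {set C}) o g,
    [/\ @cube_colouring 'I_n C o g, forall x i, g x i \in A
      & #|A| = sa (hypercube n)].
Proof.
rewrite /sa; case: ex_minnP => m /existsP[D /andP[galD /eqP cardD]] _.
have [leaf [col [leafC colC leafP]]] := star_colouring_of_partition galD.
have adjF x i : @adj (hypercube n) x (flip x i) by apply/cube_adjP; exists i.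
exists _, D, (fun x i => leaf x (flip x i)), (fun x i => col x (flip x i)).
split=> // [|x i]; last by have [] := colC _ _ (adjF x i).
split=> [x i|x i|x i j lxi e]; rewrite ?flipK.
- exact: leafC.
- by have [] := colC _ _ (adjF x i).
- by apply: (@flip_inj _ x); apply: leafP lxi e.
Qed.

(** An injection of the directions makes the smaller cube a subcube of the larger
one, and the colouring is restricted to it. *)
Lemma cube_colourable_inj (I J : finType) (C : Type) (f : I -> J) :
  injective f -> cube_colourable J C -> cube_colourable I C.
Proof.
move=> f_inj [o [g [oF gF ogP]]].
pose ext (x : {ffun I -> bool}) : {ffun J -> bool} :=
  [ffun j => [exists i, (f i == j) && x i]].
have extF x i : ext (flip x i) = flip (ext x) (f i).
  have extE z i' : ext z (f i') = z i'.
    rewrite ffunE; apply/existsP/idP => [[i2 /andP[/eqP/f_inj->]]//|zi].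
    by exists i'; rewrite eqxx.
  apply/ffunP=> j; rewrite [RHS]ffunE.
  have [/existsP[i' /eqP<-]|] := boolP [exists i', f i' == j].
    by rewrite !extE ffunE (inj_eq f_inj).
  rewrite negb_exists => /forallP nj; rewrite eq_sym (negPf (nj i)) addbF !ffunE.
  by apply: eq_existsb => i'; rewrite (negPf (nj i')).
exists (fun x i => o (ext x) (f i)), (fun x i => g (ext x) (f i)).
split=> [x i|x i|x i j oxi e]; rewrite ?extF //.
by apply: f_inj; apply: ogP oxi e.
Qed.

(** The edges of a product of two cubes lie in copies of one factor or the other;
each factor keeps its own colours. *)
Lemma cube_colourable_sum (I J : finType) (C D : Type) :
  cube_colourable I C -> cube_colourable J D ->
  cube_colourable (I + J)%type (C + D)%type.
Proof.
case=> [o1 [g1 [o1F g1F og1P]]] [o2 [g2 [o2F g2F og2P]]].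
pose lft (x : {ffun I + J -> bool}) := [ffun i => x (inl i)].
pose rgt (x : {ffun I + J -> bool}) := [ffun i => x (inr i)].
have lftF x i : lft (flip x (inl i)) = flip (lft x) i.
  by apply/ffunP=> j; rewrite !ffunE.
have rgtF x i : rgt (flip x (inr i)) = flip (rgt x) i.
  by apply/ffunP=> j; rewrite !ffunE.
exists (fun x i => match i with inl i => o1 (lft x) i | inr i => o2 (rgt x) i end).
exists (fun x i => match i with inl i => inl (g1 (lft x) i)
                              | inr i => inr (g2 (rgt x) i) end).
split=> [x [i|i]|x [i|i]|x [i|i] [j|j] //= oxi [e]]; rewrite /= ?lftF ?rgtF //.
- by rewrite g1F.
- by rewrite g2F.
- by rewrite (og1P _ _ _ oxi e).
- by rewrite (og2P _ _ _ oxi e).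
Qed.

Lemma cube_colourable_unit : cube_colourable unit unit.
Proof.
exists (fun x i => x i), (fun _ _ => tt).
by split=> [x i|//|x [] []//]; rewrite ffunE eqxx addbT.
Qed.

Lemma sa_hypercube_le (n : nat) (I C : finType) :
  0 < n <= #|I| -> cube_colourable I C -> sa (hypercube n) <= #|C|.
Proof.
case/andP=> n0 nI colI.
have f_inj : injective (fun i : 'I_n => enum_val (widen_ord nI i)).
  by move=> i j /enum_val_inj/(congr1 val) /= /val_inj.
have [o [g [oF gF ogP]]] := cube_colourable_inj f_inj colI.
pose dir (x y : {ffun 'I_n -> bool}) := odflt (Ordinal n0) [pick i | x i != y i].
have dirE x i : dir x (flip x i) = i.
  rewrite /dir; case: pickP => [j|/(_ i)]; rewrite !ffunE ?eqxx.
    by have [//|_] := eqVneq j i; rewrite addbF eqxx.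
  by case: (x i).
have dirC x y : dir y x = dir x y.
  by congr odflt; apply: eq_pick => i; rewrite eq_sym.
rewrite -cardsT.
apply: (@sa_le_colours (hypercube n) C [set: C]
  (fun x y => o x (dir x y)) (fun x y => g x (dir x y))).
split=> [x y /cube_adjP[i ->]|x y /cube_adjP[i ->]|x y z].
- by rewrite /= (dirC x) dirE oF.
- by rewrite /= (dirC x) dirE gF inE.
- by case/cube_adjP=> i -> /cube_adjP[j ->]; rewrite !dirE => oxi /(ogP _ _ _ oxi)->.
Qed.

(** * Cubes with few colours *)

Section LowerBound.

Variables (I C : finType) (A : {set C}).
Variables (o : {ffun I -> bool} -> I -> bool) (g : {ffun I -> bool} -> I -> C).
Hypothesis og : cube_colouring o g.
Hypothesis gA : forall x i, g x i \in A.

Let out x := [set i | o x i].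

(** Double counting: flipping exchanges the two ends of each edge. *)
Lemma sum_flip (F : {ffun I -> bool} -> I -> nat) :
  \sum_x \sum_i F (flip x i) i = \sum_x \sum_i F x i.
Proof.
rewrite exchange_big [RHS]exchange_big; apply: eq_bigr => i _ /=.
by rewrite [RHS](reindex_inj (inv_inj (@flipK I i))).
Qed.

Lemma card_out x : #|g x @: out x| = #|out x|.
Proof.
have [_ _ ogP] := og.
by rewrite card_in_imset // => i j; rewrite inE => oxi _; apply: ogP.
Qed.

Lemma sum_out : \sum_x (#|out x|).*2 = \sum_(x : {ffun I -> bool}) #|I|.
Proof.
have [oF _ _] := og.
have outE x : #|out x| = \sum_i o x i by rewrite -sum1dep_card big_mkcond.
under eq_bigr => x _ do rewrite -addnn outE.
rewrite big_split /= -{1}(sum_flip (fun x i => o x i)) -big_split /=.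
apply: eq_bigr => x _; rewrite -big_split /= -sum1_card; apply: eq_bigr => i _.
by rewrite oF; case: (o x i).
Qed.

Hypothesis I2 : 2 < #|I|.
Hypothesis A_small : #|A| <= #|I|./2.+1.

(** If the outgoing edges at [x] carried all the colours, then no edge could come
into [x]: the dimension would equal the number of colours, which is too small. *)
Lemma out_lt x : #|out x| < #|A|.
Proof.
have [_ _ ogP] := og.
have sA : g x @: out x \subset A by apply/subsetP=> _ /imsetP[i _ ->].
rewrite -card_out ltnNge; apply/negP => leA.
have eA : g x @: out x = A by apply/eqP; rewrite eqEcard sA.
have outT : out x = setT.
  apply/setP=> j; rewrite inE in_setT.
  have := gA x j; rewrite -eA => /imsetP[i]; rewrite inE => oxi e.
  by rewrite -(ogP x i j).
have := card_out x; rewrite eA outT cardsT; lia.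
Qed.

(** No out-degree exceeds half the degree, which is also their average. *)
Lemma out_half x : (#|out x|).*2 = #|I|.
Proof.
have le_out y : (#|out y|).*2 <= #|I| by have := out_lt y; lia.
have /eqP := sum_out; rewrite (leqif_sum (fun y _ => leqif_eq (le_out y))).
by move=> /forallP/(_ x) /eqP.
Qed.

Lemma card_colours x : #|A| = (#|out x|).+1.
Proof. have := out_lt x; have := out_half x; lia. Qed.

(** The outgoing edges at [x] use all colours but one, and an incoming edge avoids
their colours. *)
Lemma missing_colour x c i : c \in A -> c \notin g x @: out x ->
  ~~ o x i -> g x i = c.
Proof.
have [_ _ ogP] := og.
move=> cA cx oxi.
have gx : g x i \notin g x @: out x.
  apply/negP=> /imsetP[j]; rewrite inE => oxj e.
  by rewrite -(ogP x j i oxj (esym e)) oxj in oxi.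
have /cards1P[d dE] : #|A :\: g x @: out x| == 1.
  rewrite cardsD (setIidPr _) ?card_out ?(card_colours x) ?subSnn //.
  by apply/subsetP=> _ /imsetP[j _ ->].
have: g x i \in A :\: g x @: out x by rewrite !inE gx gA.
have: c \in A :\: g x @: out x by rewrite !inE cx cA.
by rewrite dE !inE => /eqP-> /eqP.
Qed.

(** For a fixed colour [c], let [W] be the set of vertices without outgoing edge
coloured [c]. The edges coloured [c] number [#|~: W|] when counted at their tails
and [#|W|] times half the dimension when counted at their heads. *)
Lemma few_colours_power2 : exists a, #|I| = 2 ^ a - 2.
Proof.
suff /(dvdn_pfactor _ _ (isT : prime 2))[a _ e] : (#|I|./2).+1 %| 2 ^ #|I|.
  exists a.+1; rewrite expnS -e.
  by have := out_half [ffun=> true]; lia.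
have [oF gF ogP] := og.
have /card_gt0P[c cA] : 0 < #|A| by rewrite (card_colours [ffun=> true]).
pose W := [set x | c \notin g x @: out x].
have outW x : \sum_i (o x i && (g x i == c)) = (x \notin W).
  rewrite inE negbK; have [/imsetP[i]|cx] := boolP (c \in g x @: out x).
    rewrite inE => oxi ->; rewrite (bigD1 i) //= oxi eqxx big1 // => j ji.
    by apply/eqP; rewrite eqb0; apply: contraNN ji => /andP[_ /eqP/esym/(ogP _ _ _ oxi)->].
  rewrite big1 // => i _; apply/eqP; rewrite eqb0.
  apply: contraNN cx => /andP[oxi /eqP<-].
  by apply: imset_f; rewrite inE.
have inW x : \sum_i (~~ o x i && (g x i == c)) = (x \in W) * #|I|./2.
  rewrite inE; have [/imsetP[i]|cx] := boolP (c \in g x @: out x).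
    rewrite inE => oxi ->; rewrite big1 // => j _; apply/eqP; rewrite eqb0.
    by apply/negP=> /andP[oxj /eqP/esym/(ogP _ _ _ oxi) eij]; rewrite -eij oxi in oxj.
  have <- : #|~: out x| = #|I|./2.
    by have := cardsC (out x); have := out_half x; lia.
  rewrite mul1n -sum1_card [RHS]big_mkcond /=; apply: eq_bigr => i _.
  by rewrite !inE; case: ifP => // oxi; rewrite (missing_colour cA cx oxi) eqxx.
have: \sum_x (x \notin W : nat) = \sum_x (x \in W) * #|I|./2.
  rewrite -(eq_bigr _ (fun x _ => outW x)) -(eq_bigr _ (fun x _ => inW x)).
  rewrite -(sum_flip (fun x i => o x i && (g x i == c) : nat)).
  by apply: eq_bigr => x _; apply: eq_bigr => i _; rewrite oF gF.
rewrite -big_distrl /= -!big_mkcond !sum1_card => e.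
have := cardsC W; rewrite card_ffun card_bool => <-.
apply/dvdnP; exists #|W|.
rewrite mulnS -e; congr addn; apply: eq_card => x; by rewrite inE.
Qed.

End LowerBound.

(** * Colouring edges by the syndrome of their head *)

(** Edges labelled [None] by [e] get the syndrome of their head as colour, the others
keep their label. An edge coming into [x] with the syndrome of [x] as colour does
not share it with an edge leaving [x] in direction [j], since [phi j != 0]. In
characteristic 2, flipping a coordinate either way adds its vector to the
syndrome. *)
Lemma syndrome_colouring (V : zmodType) (I : finType) (D : Type) (phi : I -> V)
    (o : {ffun I -> bool} -> I -> bool) (e : {ffun I -> bool} -> I -> option D) :
  (forall v : V, v + v = 0)%R -> (forall i, phi i != 0%R) ->
  (forall x i, o (flip x i) i = ~~ o x i) ->
  (forall x i, e (flip x i) i = e x i) ->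
  (forall x i j, o x i -> o x j -> e x i = None -> e x j = None ->
     phi i = phi j -> i = j) ->
  (forall x i j d, o x i -> e x i = Some d -> e x j = Some d -> i = j) ->
  cube_colourable I (V + D)%type.
Proof.
move=> exp2 phi0 oF eF eNone eSome.
pose c (x : {ffun I -> bool}) : V := (\sum_i phi i *+ x i)%R.
have cF x i : (c (flip x i) = c x + phi i)%R.
  rewrite /c (bigD1 i) // [in RHS](bigD1 i) //= ffunE eqxx addbT.
  rewrite addrAC; congr (_ + _)%R.
    by case: (x i); rewrite /= ?mulr1n ?mulr0n ?exp2 ?add0r.
  by apply: eq_bigr => j ji; rewrite ffunE (negPf ji) addbF.
exists o, (fun x i => if e x i is Some d then inr d
                      else inl (c x + phi i *+ o x i)%R).
split=> // [x i|x i j oxi].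
  rewrite eF oF cF; case: (e x i) => //; congr inl; rewrite -addrA; congr (_ + _)%R.
  by case: (o x i); rewrite /= ?mulr1n ?mulr0n ?addr0.
case ei: (e x i) => [d|]; case ej: (e x j) => [d'|] //.
  by case=> ed; apply: (eSome x i j d oxi ei); rewrite ej ed.
case=> /addrI; rewrite oxi mulr1n; case oxj: (o x j).
  by rewrite mulr1n; apply: eNone ei ej.
by rewrite mulr0n => /eqP; rewrite (negPf (phi0 i)).
Qed.

(** The requirements of [syndrome_colouring] on a set of directions that all carry
the same vector: at most one edge labelled [None] leaves each vertex. *)
Definition head_colouring (J : finType) (D : Type)
    (o : {ffun J -> bool} -> J -> bool) (e : {ffun J -> bool} -> J -> option D) :=
  [/\ forall x i, o (flip x i) i = ~~ o x i,
      forall x i, e (flip x i) i = e x i,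
      forall x i j, o x i -> o x j -> e x i = None -> e x j = None -> i = j
    & forall x i j d, o x i -> e x i = Some d -> e x j = Some d -> i = j].

(** The 4-cycle is oriented cyclically. *)
Lemma head_colouring_square :
  head_colouring (fun (x : {ffun bool -> bool}) i => (x false == x true) == i)
                 (fun _ _ => None : option void).
Proof.
split=> // [x i|x i j /eqP<- /eqP<-//]; rewrite !ffunE.
by case: (x false); case: (x true); case: i.
Qed.

(** In Q_5 the pattern depends only on the two parities [p] and [q], that is on the
image of a vertex under the linear map to F_2^2 that sends the five directions
to a, a, b, b, a + b with a = (1,0) and b = (0,1). The label [Some false] is
centred at the vertices with (p, q) = (0, 0) and [Some true] at those with
(p, q) = (1, 0). Each of the four classes of vertices has exactly one outgoing
edge labelled [None], and one for each of the two other labels of which it is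
not the centre; these ten outgoing edges are all the edges of the quotient
multigraph. *)
Section FiveCube.

Let J : finType := option (bool * bool).
Let p (x : {ffun J -> bool}) :=
  x (Some (false, false)) (+) x (Some (false, true)) (+) x None.
Let q (x : {ffun J -> bool}) :=
  x (Some (true, false)) (+) x (Some (true, true)) (+) x None.

Definition five_out (x : {ffun J -> bool}) (i : J) : bool :=
  match i with
  | Some (false, b) => p x == b
  | Some (true, b) => q x != b
  | None => q x
  end.

Definition five_label (x : {ffun J -> bool}) (i : J) : option bool :=
  match i with
  | Some (false, b) => if q x then None else Some (~~ b)
  | Some (true, b) => if b then None else Some (p x)
  | None => Some (p x (+) q x)
  end.

Lemma head_colouring_five : head_colouring five_out five_label.
Proof.
have pF x i : p (flip x i) = p x (+) (if i is Some (b, _) then ~~ b else true).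
  rewrite /p !ffunE; case: i => [[[] []]|] /=; rewrite ?addbF ?addbT //;
  by do 3!case: (x _).
have qF x i : q (flip x i) = q x (+) (if i is Some (b, _) then b else true).
  rewrite /q !ffunE; case: i => [[[] []]|] /=; rewrite ?addbF ?addbT //;
  by do 3!case: (x _).
split=> [x i|x i|x i j|x i j d].
- by case: i => [[[] b]|]; rewrite /= ?pF ?qF; case: (p x); case: (q x) => //; case: b.
- by case: i => [[[] b]|]; rewrite /= ?pF ?qF; case: (p x); case: (q x).
- case: i => [[[] []]|]; case: j => [[[] []]|] //=; by case: (p x); case: (q x).
- case: d; case: i => [[[] []]|]; case: j => [[[] []]|] //=; by case: (p x); case: (q x).
Qed.

End FiveCube.

(** The directions in [J] carry the vector [h0], and every other nonzero vector is
carried by two directions, whose 4-cycles are oriented cyclically. *)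
Lemma cube_colourable_block (V : finZmodType) (h0 : V) (J : finType) (D : Type)
    (o : {ffun J -> bool} -> J -> bool) (e : {ffun J -> bool} -> J -> option D) :
  (forall v : V, v + v = 0)%R -> h0 != 0%R -> head_colouring o e ->
  cube_colourable ({h : V | (h != 0%R) && (h != h0)} * bool + J)%type (V + D)%type.
Proof.
move=> exp2 h00 [oF eF eNone eSome].
pose H : finType := {h : V | (h != 0%R) && (h != h0)}.
pose I : finType := (H * bool + J)%type.
pose sq (x : {ffun I -> bool}) h := x (inl (h, false)) == x (inl (h, true)).
pose rgt (x : {ffun I -> bool}) := [ffun j => x (inr j)].
have rgtF x j : rgt (flip x (inr j)) = flip (rgt x) j.
  by apply/ffunP=> j'; rewrite !ffunE.
have sqF x h b : sq (flip x (inl (h, b))) h = ~~ sq x h.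
  rewrite /sq !ffunE !(inj_eq (@inl_inj _ _)) -!pair_eqE /= eqxx.
  by case: (x _); case: (x _); case: b.
apply: (@syndrome_colouring V I D
  (fun i => match i with inl (h, _) => val h | inr _ => h0 end)
  (fun x i => match i with inl (h, b) => sq x h == b | inr j => o (rgt x) j end)
  (fun x i => match i with inl _ => None | inr j => e (rgt x) j end)) => //.
- by case=> [[h b]|j] //=; have /andP[] := valP h.
- by move=> x [[h b]|j] /=; rewrite ?sqF ?rgtF ?oF //; case: (sq x h); case: b.
- by move=> x [[h b]|j] //=; rewrite rgtF eF.
- move=> x [[h b]|j] [[h' b']|j'] //=.
  + by move=> /eqP<- /eqP<- _ _ /val_inj->.
  + by move=> _ _ _ _ ehh; have := valP h; rewrite /= ehh eqxx andbF.
  + by move=> _ _ _ _ ehh; have := valP h'; rewrite /= -ehh eqxx andbF.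
  + by move=> oj oj' ej ej' _; rewrite (eNone _ _ _ oj oj').
- by move=> x [//|j] [//|j'] d /= oj ej ej'; rewrite (eSome _ _ _ _ oj ej ej').
Qed.

Lemma card_block_directions (V : finZmodType) (h0 : V) (J : finType) : h0 != 0%R ->
  #|{: {h : V | (h != 0%R) && (h != h0)} * bool + J}| = #|V|.*2 - 4 + #|J|.
Proof.
move=> h00; rewrite card_sum card_prod card_bool card_sig.
have <- : #|[set 0%R; h0]| + #|[pred h : V | (h != 0%R) && (h != h0)]| = #|V|.
  rewrite -(cardC (mem [set 0%R; h0])); congr addn.
  by apply: eq_card => h; rewrite !inE negb_or.
by rewrite cards2 eq_sym h00 add2n !doubleS !subSS subn0 muln2.
Qed.

Lemma cube_colourable_power2_block (r : nat) (J : finType) (D : finType) o e :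
  0 < r -> @head_colouring J D o e ->
  exists I C : finType,
    [/\ cube_colourable I C, #|I| = 2 ^ r.+1 - 4 + #|J| & #|C| = 2 ^ r + #|D|].
Proof.
case: r => // r _ oe; pose V : finZmodType := 'rV['F_2]_r.+1.
have cardV : #|V| = 2 ^ r.+1 by rewrite card_mx card_Fp // mul1n.
have exp2 (v : V) : (v + v = 0)%R.
  apply/rowP=> i; rewrite !mxE; apply/val_inj; case: (v _ _) => -[|[|[]]] //.
have h00 : (const_mx 1%R : V) != 0%R.
  by apply/eqP=> /rowP/(_ ord0); rewrite !mxE.
set h0 := const_mx _ in h00.
exists ({h : V | (h != 0%R) && (h != h0)} * bool + J)%type, (V + D)%type.
split; first exact: cube_colourable_block exp2 h00 oe.
  by rewrite card_block_directions // cardV (expnS 2 r.+1) mul2n.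
by rewrite card_sum cardV.
Qed.

Lemma cube_colourable_power2_sub2 (r : nat) : 0 < r -> exists I C : finType,
  [/\ cube_colourable I C, #|I| = 2 ^ r.+1 - 2 & #|C| = 2 ^ r].
Proof.
move=> r0; have [I [C [col cI cC]]] :=
  cube_colourable_power2_block r0 head_colouring_square.
exists I, C; split=> //; last by rewrite cC card_void addn0.
rewrite cI card_bool; have : 1 < 2 ^ r by rewrite -(expn0 2) ltn_exp2l.
by rewrite expnS; lia.
Qed.

Lemma cube_colourable_power2_add1 (r : nat) : 0 < r -> exists I C : finType,
  [/\ cube_colourable I C, #|I| = 2 ^ r.+1 + 1 & #|C| = 2 ^ r + 2].
Proof.
move=> r0; have [I [C [col cI cC]]] :=
  cube_colourable_power2_block r0 head_colouring_five.
exists I, C; split=> //; last by rewrite cC card_bool.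
rewrite cI card_option card_prod card_bool.
have : 1 < 2 ^ r by rewrite -(expn0 2) ltn_exp2l.
by rewrite expnS; lia.
Qed.

(** * Star arboricity near powers of two *)

Theorem lemma5 (k n : nat) (hk : 2 <= k) (hn : 2 <= n)
  (hkn : n = 2 ^ k + 4 \/ (2 ^ k - 4 <= n /\ n <= 2 ^ k + 2))
  (hna : forall a : nat, 2 <= a -> n <> 2 ^ a - 2) :
  sa (hypercube n) = n %/ 2 + 2.
Proof.
apply/eqP; rewrite eqn_leq; apply/andP; split; last first.
  rewrite leqNgt; apply/negP=> sa_lt.
  have [C [A [o [g [og gA cardA]]]]] := cube_colouring_of_sa n.
  have n2 : n <> 2 := hna 2 isT.
  have [a] : exists a, #|'I_n| = 2 ^ a - 2.
    by apply: (few_colours_power2 og gA); rewrite ?cardA card_ord; lia.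
  rewrite card_ord; case: a => [|[|a]] e; [by lia|by lia|].
  exact: (hna a.+2).
case: k hk hkn => [//|r] r0 hkn.
have n0 : 0 < n by lia.
have [I [C [colI cI cC]]] := cube_colourable_power2_sub2 r0.
have [I' [C' [colI' cI' cC']]] := cube_colourable_power2_add1 r0.
have r1 : 1 < 2 ^ r by rewrite -(expn0 2) ltn_exp2l.
have hnr := hna r.+1 r0.
rewrite expnS in hkn hnr cI cI'.
have bound (J B : finType) : cube_colourable J B -> n <= #|J| ->
    #|B| <= n %/ 2 + 2 -> sa (hypercube n) <= n %/ 2 + 2.
  by move=> colJ nJ; apply: leq_trans; apply: sa_hypercube_le colJ; rewrite n0.
have [n1|n1] := leqP n (2 * 2 ^ r - 2); first by apply: (bound _ _ colI); lia.
have [n2|n2] := leqP n (2 * 2 ^ r - 1).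
  by apply: (bound _ _ (cube_colourable_sum colI cube_colourable_unit));
    rewrite card_sum card_unit; lia.
have [n3|n3] := leqP n (2 * 2 ^ r + 1); first by apply: (bound _ _ colI'); lia.
have [n4|n4] := leqP n (2 * 2 ^ r + 2).
  by apply: (bound _ _ (cube_colourable_sum colI' cube_colourable_unit));
    rewrite card_sum card_unit; lia.
(* The last dimension is 2^k + 4 = (2^k - 2) + 6, where 6 = 2^3 - 2. *)
have [I6 [C6 [colI6 cI6 cC6]]] := cube_colourable_power2_sub2 (isT : 0 < 2).
by apply: (bound _ _ (cube_colourable_sum colI colI6)); rewrite card_sum; lia.
Qed.
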